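(* Let $V_j$ ($0\le j\le J$) be the exact solution values and $V^k_j$ ($0\le k\le J$, $0\le j\le J$) the GParareal iterates for the scalar autonomous initial value problem $\frac{\mathrm{d}u}{\mathrm{d}t}=f(u(t))$ on $[t_0,T]$, $u(t_0)=u_0\in\mathcal{U}$, as defined in the context, and let $e^k_j := |V_j-V^k_j|$. Suppose that: (1) (Exact fine solver) $\mathcal{F}_{\Delta T}$ solves the initial value problem exactly, so that $V_j=\mathcal{F}_{\Delta T}(V_{j-1})$ for $j=1,\dots,J$. (2) (One-step coarse solver) $\mathcal{G}_{\Delta T}$ is a one-step numerical solver with uniform local truncation error $\mathcal{O}(\Delta T^{p+1})$, for some $p\ge 1$, such that $\mathcal{F}_{\Delta T}(u)-\mathcal{G}_{\Delta T}(u)=c_1(u)\Delta T^{p+1}+c_2(u)\Delta T^{p+2}+\cdots$ for $u\in\mathbb{R}$, with continuously differentiable functions $c_i$, $i=1,2,\dots$, and, with $C_1>0$ the Lipschitz constant of $c_1$, $$\bigl|(\mathcal{F}_{\Delta T}(u)-\mathcal{G}_{\Delta T}(u))-(\mathcal{F}_{\Delta T}(v)-\mathcal{G}_{\Delta T}(v))\bigr|\le C_1\,\Delta T^{p+1}\,|u-v|\qquad\text{for all }u,v\in\mathbb{R}.$$ (3) (Lipschitz coarse solver) There is $L_{\mathcal{G}}>0$ such that $|\mathcal{G}_{\Delta T}(u)-\mathcal{G}_{\Delta T}(v)|\le L_{\mathcal{G}}|u-v|$ for all $u,v\in\mathbb{R}$. (4) $\mathcal{U}\subset\mathbb{R}$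 is a bounded interval, $\kappa$ is the square exponential kernel, the correction function $g=\mathcal{F}_{\Delta T}-\mathcal{G}_{\Delta T}$ (on $\mathcal{U}$) belongs to the reproducing kernel Hilbert space $H_\kappa(\mathcal{U})$, and, for a given $\tau\in\mathbb{N}$ with associated constants $h_0(\tau)$ and $C_\tau>0$ (see context), the fill distance of the dataset at iteration $k$ satisfies $h_{\boldsymbol{x}_k}\le h_0(\tau)$. Then the absolute error of the GParareal solution at iteration $k$ and time $t_j$ satisfies $$e^k_j\le\begin{cases}\Lambda_k\displaystyle\sum_{i=0}^{j-(k+1)}A^i, & 1\le k<j\le J,\\[0.5em] 0, & 0\le j\le k\le J,\end{cases}$$ where $A=C_1\Delta T^{p+1}+L_{\mathcal{G}}$ and $\Lambda_k=C_\tau\,h_{\boldsymbol{x}_k}^{\tau}\,|g|_{H_\kappa(\mathcal{U})}$.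
   Context: **Problem and mesh.** Consider the scalar autonomous initial value problem $\frac{\mathrm{d}u}{\mathrm{d}t}=f(u(t))$ on $[t_0,T]$, $u(t_0)=u_0\in\mathcal{U}\subset\mathbb{R}$, with $f$ sufficiently smooth. Fix $J\in\mathbb{N}$, $\Delta T=(T-t_0)/J$ and $t_j=t_0+j\Delta T$ for $j=0,\dots,J$. **Solvers.** The fine solver $\mathcal{F}_{\Delta T}$ and the coarse solver $\mathcal{G}_{\Delta T}$ are one-step numerical integrators, i.e. maps $\mathbb{R}\to\mathbb{R}$ that take an initial value at some $t_j$ and return an (approximate) solution value at $t_{j+1}=t_j+\Delta T$. The exact solution values are $V_0=u_0$ and $V_j=\mathcal{F}_{\Delta T}(V_{j-1})$, $j=1,\dots,J$. The correction function is $g:=\mathcal{F}_{\Delta T}-\mathcal{G}_{\Delta T}$. **Kernel and Gaussian process posterior mean.** The square exponential (SE) kernel is $\kappa(x,x')=\sigma^2\exp\left(-\frac{(x-x')^2}{2\ell^2}\right)$, $x,x'\in\mathcal{U}$, with hyperparameters $\sigma,\ell>0$ (those in use at the iteration under consideration). For vectors $\boldsymbol{x},\boldsymbol{x}'$ of points of $\mathcal{U}$, $K(\boldsymbol{x},\boldsymbol{x}')$ is the matrix with entries $\kappa(x_i,x'_j)$. Given the input dataset $\boldsymbol{x}_k$ and output dataset $\boldsymbol{y}_k=(g(x))_{x\in\boldsymbol{x}_k}$ at iteration $k$, the zero-prior-mean Gaussian process posterior mean is $$\hat\mu(x')=K(x',\boldsymbol{x}_k)\,[K(\boldsymbol{x}_k,\boldsymbol{x}_k)]^{-1}\,\boldsymbol{y}_k,\qquad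 x'\in\mathcal{U}.$$ (It depends on $k$; this is suppressed in the notation. The points of $\boldsymbol{x}_k$ are taken distinct, so that the matrix is invertible.) **GParareal iterates.** For all $k\ge0$, $V^k_0=V_0=u_0$. Iteration $0$: $V^0_j=\mathcal{G}_{\Delta T}(V^0_{j-1})$, $j=1,\dots,J$. At iteration $k\ge1$, $\mathcal{F}_{\Delta T}$ and $\mathcal{G}_{\Delta T}$ have been evaluated at the not-yet-converged values $V^{k-1}_j$, $j=k-1,\dots,J-1$, of the previous iteration, and these evaluations are added to the dataset. Thus $\boldsymbol{x}_k$ collects the points $V^m_j$ with $0\le m\le k-1$ and $m\le j\le J-1$, and $\boldsymbol{y}_k$ the corresponding values of $g$. The values already obtained by successive fine propagation of the exact initial value are kept: $V^k_j=\mathcal{F}_{\Delta T}(V^{j-1}_{j-1})$ for $1\le j\le k$. The remaining values are given by the update rule $$V^k_j=\mathcal{G}_{\Delta T}(V^k_{j-1})+\hat\mu(V^k_{j-1}),\qquad 1\le k<j\le J,$$ with $\hat\mu$ built from $\boldsymbol{x}_k,\boldsymbol{y}_k$ and $\kappa$. No values are frozen early by a stopping tolerance. All values $V_j$, $V^k_j$ are assumed to lie in $\mathcal{U}$. **Fill distance.** $h_{\boldsymbol{x}_k}:=\sup_{v\in\mathcal{U}}\inf_{v_i\in\boldsymbol{x}_k}|v-v_i|$. **RKHS.** $H_\kappa(\mathcal{U})$ is the reproducing kernel Hilbert space of functions $\mathcal{U}\to\mathbb{R}$ with kernel $\kappa$, with inner product $\langle\cdot,\cdot\rangle_{H_\kappa(\mathcal{U})}$,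 and $|g|^2_{H_\kappa(\mathcal{U})}=\langle g,g\rangle_{H_\kappa(\mathcal{U})}$. **The constants $h_0(\tau)$ and $C_\tau$.** For $\tau\in\mathbb{N}$, $h_0(\tau)$ and $C_\tau>0$ denote constants for which the following known consistency estimate (adapted from Wendland, *Scattered Data Approximation*, Theorem 11.14), valid for $\mathcal{U}\subset\mathbb{R}$ a bounded interval, $\kappa$ the SE kernel and $g\in H_\kappa(\mathcal{U})$, holds: if $h_{\boldsymbol{x}_k}\le h_0(\tau)$ then $$|g(v)-\hat\mu(v)|\le C_\tau\,h_{\boldsymbol{x}_k}^{\tau}\,|g|_{H_\kappa(\mathcal{U})}\qquad\text{for all }v\in\mathcal{U}.$$ Such constants exist for every $\tau\in\mathbb{N}$. *)

(* Defs.v *)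
From HB Require Import structures.
From mathcomp Require Import all_boot all_order all_algebra.
From mathcomp Require Import all_classical all_reals all_analysis.
Set Implicit Arguments.
Unset Strict Implicit.
Unset Printing Implicit Defensive.
Import Order.TTheory GRing.Theory Num.Theory.
Import numFieldNormedType.Exports.
Local Open Scope classical_set_scope.
Local Open Scope ring_scope.

Definition continuously_differentiable (R : realType) (c : R -> R) : Prop :=
  (forall x, derivable c x 1) /\ continuous (derive1 c).

(* With f continuous, the ODE on the open interval and continuity up to the
   endpoints also give the one-sided derivatives at a and b. *)
Definition solves_ode (R : realType) (f : R -> R) (a b : R) (phi : R -> R) :
    Prop :=
  derivable_oo_LRcontinuous phi a b /\
  forall t, t \in `]a, b[ -> derive1 phi t = f (phi t).

(* Solvers are families indexed by the step size: F h v is the value returned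
   after one step of length h from v. Nothing is required of F h v when the
   solution starting at v does not exist up to time h. *)
Definition exact_solver (R : realType) (f : R -> R) (dT : R)
    (F : R -> R -> R) : Prop :=
  forall (h s : R) (phi : R -> R), 0 < h <= dT ->
    solves_ode f s (s + h) phi -> F h (phi s) = phi (s + h).

Definition uniform_truncation_error (R : realType) (U : set R)
    (F G : R -> R -> R) (p : nat) : Prop :=
  exists M : R, \forall h \near 0^'+,
    forall u, U u -> `|F h u - G h u| <= M * h ^+ p.+1.

(* F h u - G h u = c 1 u * h^(p+1) + c 2 u * h^(p+2) + ... as h -> 0+, read as
   an asymptotic expansion; c 0 plays no role. *)
Definition truncation_expansion (R : realType) (F G : R -> R -> R) (p : nat)
    (c : nat -> R -> R) : Prop :=
  forall (u : R) (n : nat), exists M : R, \forall h \near 0^'+,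
    `|F h u - G h u - \sum_(1 <= i < n.+1) c i u * h ^+ (p + i)|
      <= M * h ^+ (p + n.+1).

Definition se_kernel (R : realType) (sigma ell x x' : R) : R :=
  sigma ^+ 2 * expR (- ((x - x') ^+ 2 / (2 * ell ^+ 2))).

Definition se_kernel_on (R : realType) (U : set R) (sigma ell : R)
    (x x' : U) : R := se_kernel sigma ell (val x) (val x').

(* A Hilbert space of functions T -> R with reproducing kernel kappa. By
   uniqueness (Moore-Aronszajn) its carrier, and its inner product on that
   carrier, are determined by kappa. The values of rkhs_ip off the carrier are
   irrelevant. *)
Record rkhs (R : realType) (T : Type) (kappa : T -> T -> R) := Rkhs {
  rkhs_set : set (T -> R);
  rkhs_ip : (T -> R) -> (T -> R) -> R;
  rkhs_set0 : rkhs_set (fun=> 0);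
  rkhs_set_lin : forall (a : R) f g, rkhs_set f -> rkhs_set g ->
    rkhs_set (fun x => a * f x + g x);
  rkhs_ip_lin : forall (a : R) f g h,
    rkhs_set f -> rkhs_set g -> rkhs_set h ->
    rkhs_ip (fun x => a * f x + g x) h = a * rkhs_ip f h + rkhs_ip g h;
  rkhs_ip_sym : forall f g, rkhs_set f -> rkhs_set g ->
    rkhs_ip f g = rkhs_ip g f;
  rkhs_ip_pos : forall f, rkhs_set f -> f <> (fun=> 0) -> 0 < rkhs_ip f f;
  rkhs_complete : forall u : nat -> T -> R, (forall n, rkhs_set (u n)) ->
    (forall e : R, 0 < e -> exists N : nat, forall m n : nat,
      (N <= m)%N -> (N <= n)%N ->
      Num.sqrt (rkhs_ip (fun x => u m x - u n x) (fun x => u m x - u n x))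
        < e) ->
    exists2 l, rkhs_set l &
      (fun n => Num.sqrt (rkhs_ip (fun x => u n x - l x)
                                  (fun x => u n x - l x))) @ \oo --> (0 : R);
  rkhs_kernel : forall y, rkhs_set (fun x => kappa x y);
  rkhs_reproducing : forall f y, rkhs_set f ->
    rkhs_ip f (fun x => kappa x y) = f y }.

Definition rkhs_norm (R : realType) (T : Type) (kappa : T -> T -> R)
    (H : rkhs kappa) (f : T -> R) : R := Num.sqrt (rkhs_ip H f f).

Definition posterior_mean (R : realType) (kappa : R -> R -> R) (xs : seq R)
    (g : R -> R) (x' : R) : R :=
  let k := \row_(j < size xs) kappa x' xs`_j in
  let K := \matrix_(i < size xs, j < size xs) kappa xs`_i xs`_j in
  let y := \col_(i < size xs) g xs`_i in
  (k *m invmx K *m y) 0 0.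

(* Only meaningful for a nonempty dataset: inf set0 is 0 in R. *)
Definition fill_distance (R : realType) (U : set R) (xs : seq R) : R :=
  sup [set inf [set `|v - x| | x in [set` xs]] | v in U].

(* The constants do not depend on the dataset nor on the function g. *)
Definition consistency_constants (R : realType) (U : set R) (sigma ell : R)
    (H : rkhs (@se_kernel_on R U sigma ell)) (tau : nat) (h0 C : R) : Prop :=
  0 < C /\
  forall (xs : seq R) (g : R -> R),
    xs != [::] -> uniq xs -> [set` xs] `<=` U -> rkhs_set H (sigL U g) ->
    fill_distance U xs <= h0 ->
    forall v, U v ->
      `|g v - posterior_mean (se_kernel sigma ell) xs g v|
        <= C * fill_distance U xs ^+ tau * rkhs_norm H (sigL U g).

Definition exact_value (R : realType) (F : R -> R) (u0 : R) (j : nat) : R :=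
  iter j F u0.

(* undup keeps one copy of each point, so that the Gram matrix of the dataset
   is always invertible; it is the identity on a list of distinct points. *)
Definition dataset (R : realType) (J : nat) (V : nat -> nat -> R) (k : nat) :
    seq R :=
  undup [seq V m j | m <- iota 0 k, j <- iota m (J - m)].

(* V k j is the value at iteration k and time t_j; kappa k is the kernel (with
   the hyperparameters) used at iteration k >= 1. *)
Record is_gparareal (R : realType) (J : nat) (F G : R -> R)
    (kappa : nat -> R -> R -> R) (u0 : R) (V : nat -> nat -> R) : Prop := {
  gp_start : forall k, (k <= J)%N -> V k 0 = u0;
  gp_coarse : forall j, (1 <= j <= J)%N -> V 0 j = G (V 0 j.-1);
  gp_kept : forall k j, (1 <= j <= k)%N -> (k <= J)%N ->
    V k j = F (V j.-1 j.-1);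
  gp_update : forall k j, (1 <= k)%N -> (k < j)%N -> (j <= J)%N ->
    V k j = G (V k j.-1) +
      posterior_mean (kappa k) (dataset J V k) (fun v => F v - G v)
        (V k j.-1) }.

(* Main.v *)
Require Import Defs.
From HB Require Import structures.
From mathcomp Require Import all_boot all_order all_algebra.
From mathcomp Require Import all_classical all_reals all_analysis.
From mathcomp Require Import zify ring.
Set Implicit Arguments.
Unset Strict Implicit.
Unset Printing Implicit Defensive.
Import Order.TTheory GRing.Theory Num.Theory.
Import numFieldNormedType.Exports.
Local Open Scope classical_set_scope.
Local Open Scope ring_scope.

(** An update of iteration [k] is a coarse step plus a predicted correction [mu],
    which would be a fine step if [mu] were the true correction [g = F - G].
    Adding and subtracting [g] at [V k j] splits the new error
    [F (V_j) - G (V k j) - mu (V k j)], where [V_j] is the exact value, into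
    three pieces: the variation of [g]
    and the variation of [G] between [V_j] and [V k j], both Lipschitz in the
    old error, and the regression error [g - mu] at [V k j], which the
    consistency estimate bounds by the constant [Lambda].  The errors of one
    iteration thus satisfy [e (j + 1) <= A * e j + Lambda]
    ([gparareal_step_error]).

    Iteration [k] has propagated the initial value [k] times with the fine
    solver, so its error vanishes up to time index [k]
    ([gparareal_exact_prefix]).  Unrolling the recursion from there
    ([geometric_unroll]) produces the geometric sum with [j - k] terms. *)

(** Multiplying the bound by [a >= 0] and adding [b] shifts every power of [a] by
    one and restores the power zero, as in the closed form of an affine
    recursion started at zero. *)
Lemma geometric_unroll (R : realType) (a b : R) (x : nat -> R) (N : nat) :
  0 <= a -> x 0%N <= 0 ->
  (forall n, (n < N)%N -> x n.+1 <= a * x n + b) ->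
  forall n, (n <= N)%N -> x n <= b * \sum_(0 <= i < n) a ^+ i.
Proof.
move=> a_ge0 x0 step; elim=> [_|n IHn ltnN]; first by rewrite big_geq ?mulr0.
rewrite big_nat_recl // expr0 mulrDr mulr1 addrC.
apply: le_trans (step n ltnN) _; rewrite lerD2r.
under eq_bigr => i _ do rewrite exprS.
by rewrite -mulr_sumr mulrCA ler_wpM2l // IHn // ltnW.
Qed.

Section GParareal.
Variables (R : realType) (J : nat) (F G : R -> R).
Variables (kappa : nat -> R -> R -> R) (u0 : R) (V : nat -> nat -> R).
Hypothesis gpV : is_gparareal J F G kappa u0 V.

Lemma gparareal_diagonal j : (j <= J)%N -> V j j = exact_value F u0 j.
Proof.
elim: j => [|j IHj] lejJ; first exact: (gp_start gpV).
by rewrite (gp_kept gpV) //= IHj // ltnW.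
Qed.

(** A kept value is one fine step from the diagonal of the table of iterates, so
    exactness only has to be followed along that diagonal. *)
Lemma gparareal_exact_prefix k j :
  (j <= k)%N -> (k <= J)%N -> V k j = exact_value F u0 j.
Proof.
case: j => [|j] lejk lekJ; first exact: (gp_start gpV).
rewrite (gp_kept gpV) //= gparareal_diagonal //.
by rewrite ltnW // (leq_trans lejk).
Qed.

(** Writing [F] as [(F - G) + G] makes the small Lipschitz constant of the
    correction appear beside that of the coarse solver, and comparing with the
    regression only at [V k j] lets its error enter as the additive term
    [d]. *)
Lemma gparareal_step_error (l m d : R) (k j : nat) :
  (forall v w, `|(F v - G v) - (F w - G w)| <= l * `|v - w|) ->
  (forall v w, `|G v - G w| <= m * `|v - w|) ->
  (1 <= k <= j)%N -> (j < J)%N ->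
  `|(F (V k j) - G (V k j))
    - posterior_mean (kappa k) (dataset J V k) (fun v => F v - G v) (V k j)|
    <= d ->
  `|exact_value F u0 j.+1 - V k j.+1|
    <= (l + m) * `|exact_value F u0 j - V k j| + d.
Proof.
move=> lipFG lipG /andP[k_gt0 lekj] ltjJ regr.
rewrite (gp_update gpV) //= mulrDl.
set v := exact_value F u0 j; set w := V k j in regr *.
set mu := posterior_mean _ _ _ _ in regr *.
have -> : F v - (G w + mu)
    = ((F v - G v) - (F w - G w)) + (G v - G w) + ((F w - G w) - mu).
  by ring.
apply: le_trans (ler_normD _ _) (lerD _ regr).
exact: le_trans (ler_normD _ _) (lerD (lipFG _ _) (lipG _ _)).
Qed.

End GParareal.

Lemma dataset_neq_nil (R : realType) (J : nat) (V : nat -> nat -> R) k :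
  (1 <= J)%N -> (1 <= k)%N -> dataset J V k != [::].
Proof.
move=> J_gt0 k_gt0; suff: V 0 0 \in dataset J V k.
  by apply: contraTneq => ->; rewrite in_nil.
rewrite mem_undup; apply/allpairsPdep; exists 0%N, 0%N.
by rewrite !mem_iota subn0 !add0n.
Qed.

Lemma dataset_subset (R : realType) (J : nat) (V : nat -> nat -> R) k
    (U : set R) :
  (k <= J)%N ->
  (forall i j, (i <= J)%N -> (j <= J)%N -> U (V i j)) ->
  [set` dataset J V k] `<=` U.
Proof.
move=> lekJ VU x /=; rewrite mem_undup => /allpairsPdep[m [j [+ + ->]]].
rewrite !mem_iota => mk mj; apply: VU; lia.
Qed.

Theorem theorem3p5 (R : realType)
  (* initial value problem, with exact solution u, and mesh *)
  (f : R -> R) (t0 T : R) (u : R -> R) (u0 : R) (U : set R) (J : nat)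
  (hf : continuously_differentiable f) (hT : t0 < T) (hJ : (1 <= J)%N)
  (hu : solves_ode f t0 T u) (hu0 : u t0 = u0) (hU0 : U u0)
  (dT : R) (hdT : dT = (T - t0) / J%:R)
  (* solvers, indexed by the step size *)
  (F G : R -> R -> R)
  (* kernel hyperparameters, which may change with the iteration *)
  (sigma ell : nat -> R)
  (hsigma : forall i, 0 < sigma i) (hell : forall i, 0 < ell i)
  (* GParareal iterates *)
  (V : nat -> nat -> R)
  (hV : is_gparareal J (F dT) (G dT)
          (fun i => se_kernel (sigma i) (ell i)) u0 V)
  (hVU : forall i j, (i <= J)%N -> (j <= J)%N -> U (V i j))
  (hexU : forall j, (j <= J)%N -> U (exact_value (F dT) u0 j))
  (* (1) *)
  (hF : exact_solver f dT F)
  (* (2) *)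
  (p : nat) (hp : (1 <= p)%N)
  (hGp : uniform_truncation_error U F G p)
  (c : nat -> R -> R)
  (hc : forall i, (1 <= i)%N -> continuously_differentiable (c i))
  (hexp : truncation_expansion F G p c)
  (C1 : R) (hC1 : 0 < C1)
  (hc1 : forall v w, `|c 1%N v - c 1%N w| <= C1 * `|v - w|)
  (hFG : forall v w,
     `|(F dT v - G dT v) - (F dT w - G dT w)| <= C1 * dT ^+ p.+1 * `|v - w|)
  (* (3) *)
  (LG : R) (hLG : 0 < LG)
  (hG : forall v w, `|G dT v - G dT w| <= LG * `|v - w|)
  (* (4), at iteration k *)
  (hUi : is_interval U) (hUb : bounded_set U)
  (k : nat) (hk : (k <= J)%N)
  (H : rkhs (@se_kernel_on R U (sigma k) (ell k)))
  (hgH : rkhs_set H (sigL U (fun v => F dT v - G dT v)))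
  (tau : nat) (h0 Ctau : R) (hC : consistency_constants H tau h0 Ctau)
  (hfill : (1 <= k)%N -> fill_distance U (dataset J V k) <= h0) :
  let e := fun j => `|exact_value (F dT) u0 j - V k j| in
  let A := C1 * dT ^+ p.+1 + LG in
  let Lambda := Ctau * fill_distance U (dataset J V k) ^+ tau
                * rkhs_norm H (sigL U (fun v => F dT v - G dT v)) in
  (forall j, (1 <= k)%N -> (k < j)%N -> (j <= J)%N ->
     e j <= Lambda * \sum_(0 <= i < (j - k.+1).+1) A ^+ i) /\
  (forall j, (j <= k)%N -> e j <= 0).
Proof.
move=> e A Lambda.
have prefix j : (j <= k)%N -> e j <= 0.
  by move=> lejk; rewrite /e (gparareal_exact_prefix hV) // subrr normr0.
split=> // j k_gt0 ltkj lejJ.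
have A_ge0 : 0 <= A.
  have dT_ge0 : 0 <= dT by rewrite hdT divr_ge0 // subr_ge0 ltW.
  by rewrite /A addr_ge0 ?mulr_ge0 ?exprn_ge0 // ltW.
have step i : (k <= i)%N -> (i < J)%N -> e i.+1 <= A * e i + Lambda.
  move=> leki ltiJ; apply: (gparareal_step_error hV) => //; first exact/andP.
  apply: (hC.2 _ (fun v => F dT v - G dT v)) => //.
  - exact: dataset_neq_nil.
  - exact: undup_uniq.
  - exact: dataset_subset.
  - exact: hfill.
  - by apply: hVU => //; exact: ltnW.
have stepk n : (n < J - k)%N -> e (k + n.+1)%N <= A * e (k + n)%N + Lambda.
  by move=> ltn; rewrite addnS; apply: step; lia.
have e0 : e (k + 0)%N <= 0 by apply: prefix; rewrite addn0.
have := geometric_unroll (x := fun n => e (k + n)%N) A_ge0 e0 stepk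
  (leq_sub2r k lejJ).
by rewrite subnKC ?(ltnW ltkj) // -subSn // subSS.
Qed.
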